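(* Let $\sigma(x)=\sin(x)$. Let $\mu_1,\mu_2\in\mathbb R$, let $\begin{pmatrix}\nu_{11}&\nu_{12}\\ \nu_{12}&\nu_{22}\end{pmatrix}$ be positive semidefinite, and set $\nu^*=-\frac{\nu_{11}+\nu_{22}}{2}$. Then $$K_\sigma(\mu_1,\mu_2;\nu_{11},\nu_{22},\nu_{12})=\frac12\left[e^{\nu^*+\nu_{12}}-e^{\nu^*}\right]\cos(\mu_1-\mu_2)-\frac12\left[e^{\nu^*-\nu_{12}}-e^{\nu^*}\right]\cos(\mu_1+\mu_2).$$
   Context: $K_\sigma(\mu_1,\mu_2;\nu_{11},\nu_{22},\nu_{12}):=\operatorname{Cov}(\sigma(X_1),\sigma(X_2))$ where $(X_1,X_2)$ is jointly normal with means $\mu_1,\mu_2$ and covariance matrix $\begin{pmatrix}\nu_{11}&\nu_{12}\\ \nu_{12}&\nu_{22}\end{pmatrix}$. *)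

(* Defs.v *)
From HB Require Import structures.
From mathcomp Require Import all_boot all_order all_algebra.
From mathcomp Require Import all_classical all_reals all_analysis.

Set Implicit Arguments.
Unset Strict Implicit.
Unset Printing Implicit Defensive.

Import Order.TTheory GRing.Theory Num.Theory.
Import numFieldNormedType.Exports.

Local Open Scope classical_set_scope.
Local Open Scope ring_scope.

Definition psd (R : realType) (n : nat) (A : 'M[R]_n) : Prop :=
  A^T = A /\ forall v : 'cV[R]_n, 0 <= (v^T *m A *m v) 0 0.

Definition sym_mx2 (R : realType) (nu11 nu22 nu12 : R) : 'M[R]_(1 + 1) :=
  block_mx nu11%:M nu12%:M nu12%:M nu22%:M.

(* The normal law with mean m and standard deviation s. Positive semidefinite
   covariance matrices may be singular, so s = 0 must mean the point mass at m;
   [normal_prob m 0] is instead the uniform law on [0, 1]. *)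
Definition normal_law (R : realType) (m s : R) (A : set R) : \bar R :=
  if s == 0 then \d_m A else normal_prob m s A.

Definition is_normal (d : measure_display) (T : measurableType d)
    (R : realType) (P : probability T R) (Y : T -> R) : Prop :=
  exists m s : R, 0 <= s /\
    forall A : set R, measurable A -> P (Y @^-1` A) = normal_law m s A.

(* A random vector is normal iff all linear combinations of its coordinates
   are normal (possibly degenerate). *)
Definition jointly_normal (d : measure_display) (T : measurableType d)
    (R : realType) (P : probability T R) (X1 X2 : {RV P >-> R}) : Prop :=
  forall a b : R, is_normal P (fun t => a * X1 t + b * X2 t).

Definition jointly_normal_with (d : measure_display) (T : measurableType d)
    (R : realType) (P : probability T R) (X1 X2 : {RV P >-> R})
    (mu1 mu2 nu11 nu22 nu12 : R) : Prop :=
  [/\ jointly_normal X1 X2,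
      ('E_P[X1] = mu1%:E /\ 'E_P[X2] = mu2%:E)%E &
      [/\ covariance P X1 X1 = nu11%:E, covariance P X2 X2 = nu22%:E
        & covariance P X1 X2 = nu12%:E]].

(* Main.v *)
(** The centred normal law with variance s^2 satisfies Stein's identity
    E[W f(W)] = s^2 E[f'(W)], which for s <> 0 says that the integral of
    (f p)' vanishes, p being the density, and which also holds for a point
    mass (s = 0).  Taking f constant and f(w) = w identifies the parameters
    of the law with its mean and variance; taking f(w) = sin (u w + a) turns
    differentiation under the integral of phi(u) = E[cos (u W + a)] into the
    equation phi' = - s^2 u phi, so phi(1) = exp (- s^2 / 2) cos a.  The
    covariance follows from this formula for X1, X2, X1 - X2 and X1 + X2, by
    2 sin X1 sin X2 = cos (X1 - X2) - cos (X1 + X2). *)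
Require Import Defs.
From HB Require Import structures.
From mathcomp Require Import all_boot all_order all_algebra.
From mathcomp Require Import all_classical all_reals all_analysis.
From mathcomp Require Import measurable_realfun ring lra.
Import Order.TTheory GRing.Theory Num.Theory.
Import numFieldNormedType.Exports.
Local Open Scope classical_set_scope.
Local Open Scope ring_scope.

(** * Integrating a derivative over the real line *)

Lemma is_derive_continuous (R : realType) (F f : R -> R) :
  (forall x, is_derive x (1 : R) F (f x)) -> continuous F.
Proof.
by move=> dF x; apply/differentiable_continuous/derivable1_diffP; case: (dF x).
Qed.

(** The fundamental theorem of calculus on growing symmetric intervals, followed by dominated
    convergence with [|f|] as the bound. *)
Lemma Rintegral_derive_setT (R : realType) (F f : R -> R) (l l' : R) :
  (forall x, is_derive x (1 : R) F (f x)) -> continuous f ->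
  lebesgue_measure.-integrable [set: R] (EFin \o f) ->
  F x @[x --> +oo] --> l -> F x @[x --> -oo] --> l' ->
  \int[lebesgue_measure]_x f x = l - l'.
Proof.
move=> dF cf intf Fl Fl'.
have mf : measurable_fun setT f by exact: continuous_measurable_fun.
have cF := is_derive_continuous _ _ _ dF.
(* The bound [n.+1] keeps the interval nondegenerate at [n = 0], as [continuous_FTC2] demands. *)
pose D (n : nat) : set R := `[- n.+1%:R, n.+1%:R]%classic.
have intD n : (\int[lebesgue_measure]_x ((f \_ (D n)) x)%:E =
    (F n.+1%:R - F (- n.+1%:R))%:E)%E.
  rewrite -[LHS]/(\int[lebesgue_measure]_x (EFin \o f \_ (D n)) x)%E.
  rewrite -restrict_EFin -integral_mkcond /D/= (@continuous_FTC2 _ f F)//.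
  - by rewrite (lt_trans (y := 0)) ?oppr_lt0 ?ltr0n.
  - exact: continuous_subspaceT.
  - split=> [x _||]; first by case: (dF x).
      exact/cvg_at_right_filter/cF.
    exact/cvg_at_left_filter/cF.
  - by move=> x _; rewrite derive1E; case: (dF x).
have Foo : (F n.+1%:R - F (- n.+1%:R))%:E @[n --> \oo] --> (l - l')%:E.
  apply/fine_cvgP; split; first exact: nearW.
  have noo : n.+1%:R @[n --> \oo] --> (+oo : set_system R).
    by apply/cvgryPge => M; near=> n; rewrite (@le_trans _ _ n%:R) ?ler_nat//;
      near: n; exact: nbhs_infty_ger.
  apply: cvgB; first exact: (cvg_comp _ _ noo Fl).
  apply: (cvg_comp (fun n => - n.+1%:R) F _ Fl').
  exact/(cvgNrNy (fun n => n.+1%:R)).2.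
have [] := @dominated_convergence _ _ R lebesgue_measure setT measurableT
  (fun n => EFin \o (f \_ (D n))) (EFin \o f) (EFin \o (Num.norm \o f)).
- move=> n; apply/measurable_EFinP/(measurable_restrictT _ _).1.
    exact: measurable_itv.
  exact: (measurable_funS measurableT _ mf).
- exact/measurable_EFinP.
- apply: aeW => x _; apply: cvg_near_cst.
  near=> n; rewrite /= patchE mem_set//= /D/= in_itv/= -ler_norml.
  by rewrite (@le_trans _ _ n%:R) ?ler_nat//; near: n; exact: nbhs_infty_ger.
- exact: integrable_norm.
- apply: aeW => x n _; rewrite /= lee_fin patchE.
  by case: ifPn => //; rewrite normr0.
move=> _ _ /=; under eq_fun do rewrite /= intD.
move=> /(cvg_unique _ Foo) intE.
by rewrite /Rintegral -intE.
Unshelve. all: by end_near.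
Qed.

(** * Gaussian estimates and Stein's identity for the density *)

(* The two factors [1 + `|x - m|] are the growth allowed for f in Stein's
   identity and the factor x - m it produces. *)
Lemma normal_fun_domination (R : realType) (m s x : R) : s != 0 ->
  (1 + `|x - m|) ^+ 2 * normal_fun m s x <=
  (2 + 8 * s ^+ 2) * normal_fun m (Num.sqrt 2 * s) x.
Proof.
(* The Gaussian exponent is [- 2 * u]. One factor [expR (- u)] is the Gaussian with [s] widened to
   [sqrt 2 * s]; the other absorbs the polynomial, through [1 + u <= expR u] and
   [(1 + y) ^+ 2 <= 2 + 2 * y ^+ 2]. *)
move=> s0; pose u := (x - m) ^+ 2 / (4 * s ^+ 2).
have s2 : 0 < s ^+ 2 by rewrite exprn_even_gt0.
have -> : normal_fun m s x = expR (- u) * expR (- u).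
  by rewrite -expRD /normal_fun /u; congr expR; field.
have -> : normal_fun m (Num.sqrt 2 * s) x = expR (- u).
  by rewrite /normal_fun /u exprMn sqr_sqrtr//; congr expR; field.
rewrite mulrA ler_wpM2r ?expR_ge0// expRN ler_pdivrMr ?expR_gt0//.
apply: (@le_trans _ _ ((2 + 8 * s ^+ 2) * (1 + u))); last first.
  by rewrite ler_wpM2l ?expR_ge1Dx//; nra.
have u0 : 0 <= u by rewrite mulr_ge0 ?sqr_ge0// invr_ge0; nra.
have -> : (2 + 8 * s ^+ 2) * (1 + u) = 2 + 8 * s ^+ 2 + 2 * u + 2 * (x - m) ^+ 2.
  by rewrite /u; field.
rewrite -[(x - m) ^+ 2]real_normK ?num_real//.
have := sqr_ge0 (1 - `|x - m|); nra.
Qed.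

Lemma normal_fun_gauss_fun (R : realType) (m s x : R) : s != 0 ->
  normal_fun m s x = gauss_fun ((x - m) / Num.sqrt (s ^+ 2 *+ 2)).
Proof.
move=> s0; rewrite /normal_fun /gauss_fun exprMn exprVn sqr_sqrtr ?mulNr//.
by rewrite mulrn_wge0// sqr_ge0.
Qed.

Lemma cvg_normal_fun_pinfty (R : realType) (m s : R) : s != 0 ->
  normal_fun m s x @[x --> +oo] --> 0.
Proof.
move=> s0; under eq_fun do rewrite normal_fun_gauss_fun//.
apply: (cvg_comp (fun x => (x - m) / _) (@gauss_fun R)); last first.
  exact: cvg_gauss_fun.
apply/gt0_cvgMly; last exact: cvg_addrr.
by rewrite invr_gt0// sqrtr_gt0 -mulr_natr mulr_gt0// exprn_even_gt0.
Qed.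

Lemma cvg_normal_fun_ninfty (R : realType) (m s : R) : s != 0 ->
  normal_fun m s x @[x --> -oo] --> 0.
Proof.
move=> s0; apply/cvgNy_compNP.
rewrite (_ : _ \o _ = normal_fun (- m) s); first exact: cvg_normal_fun_pinfty.
by apply/funext => x; rewrite /normal_fun/= -opprD sqrrN opprK.
Qed.

Lemma is_derive_normal_pdf (R : realType) (m s x : R) : s != 0 ->
  is_derive x (1 : R) (normal_pdf m s) (- ((x - m) / s ^+ 2) * normal_pdf m s x).
Proof.
move=> s0; rewrite normal_pdfE//.
(* The exponent is built from operations on functions, so that its derivative is found by instance
   inference. *)
pose g : R -> R := (- (s ^+ 2 *+ 2)^-1) *: (id - cst m) ^+ 2.
have dg : is_derive x (1 : R) g (- ((x - m) / s ^+ 2)).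
  rewrite /g; apply: is_derive_eq; rewrite /= !fctE.
  by rewrite -mulr_natr /GRing.scale/=; field.
have gE y : expR (g y) = normal_fun m s y.
  by congr expR; rewrite /g /= !fctE /GRing.scale/= mulNr mulrC mulNr.
have := is_deriveZ (normal_peak s) (is_derive1_comp (is_derive_expR (g x)) dg).
rewrite (_ : normal_peak s \*: _ = fun y => normal_peak s * normal_fun m s y).
  by rewrite gE => ?; apply: is_derive_eq; rewrite /GRing.scale/=; ring.
by apply/funext => y; rewrite /= gE.
Qed.

(** Linear growth of [f] is allowed so that [f x = x - m] is covered. All the functions to be
    integrated, and the boundary term [f * p], are then bounded by one multiple of the wider
    Gaussian [q], which is integrable and vanishes at both infinities. *)
Lemma normal_pdf_stein (R : realType) (m s K : R) (f f' : R -> R) : s != 0 ->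
  (forall x, is_derive x (1 : R) f (f' x)) -> continuous f' ->
  (forall x, `|f x| <= K * (1 + `|x - m|)) -> (forall x, `|f' x| <= K) ->
  [/\ lebesgue_measure.-integrable [set: R]
        (fun x => ((x - m) * f x * normal_pdf m s x)%:E),
      lebesgue_measure.-integrable [set: R] (fun x => (f' x * normal_pdf m s x)%:E) &
      \int[lebesgue_measure]_x ((x - m) * f x * normal_pdf m s x) =
      s ^+ 2 * \int[lebesgue_measure]_x (f' x * normal_pdf m s x)].
Proof.
move=> s0 df cf' fK f'K.
have K0 : 0 <= K by exact: le_trans (f'K 0).
have s20 : Num.sqrt 2 * s != 0 by rewrite mulf_neq0 // sqrtr_eq0 -ltNge.
have cf := is_derive_continuous _ _ _ df.
have cp := @continuous_normal_pdf R m s s0.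
have csub : continuous (fun x : R => x - m).
  by move=> x; apply: cvgB; [exact: cvg_id|exact: cvg_cst].
pose p := normal_pdf m s; pose q := normal_fun m (Num.sqrt 2 * s).
pose C := K * (normal_peak s * (2 + 8 * s ^+ 2)).
have p0 x : 0 <= p x := normal_pdf_ge0 m s x.
have pq x : K * ((1 + `|x - m|) ^+ 2 * p x) <= C * q x.
  rewrite /C -(mulrA K) ler_wpM2l// /p normal_pdfE// [leLHS]mulrCA -[leRHS]mulrA.
  by rewrite ler_wpM2l ?normal_peak_ge0// normal_fun_domination.
have intq : lebesgue_measure.-integrable [set: R] (EFin \o q).
  have := integrableZl measurableT (normal_peak (Num.sqrt 2 * s))^-1
    (@integrable_normal_pdf R m (Num.sqrt 2 * s)).
  apply: eq_integrable => // x _.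
  rewrite normal_pdfE// -EFinM mulKf//.
  by rewrite gt_eqF// normal_peak_gt0.
have domi (h : R -> R) : continuous h -> (forall x, `|h x| <= C * q x) ->
    lebesgue_measure.-integrable [set: R] (EFin \o h).
  move=> ch hC; have mh : measurable_fun setT h by exact: continuous_measurable_fun.
  apply: le_integrable (integrableZl _ C intq) => //.
  - exact/measurable_EFinP.
  - by move=> x _; rewrite /= lee_fin (le_trans (hC x))// ler_norm.
have intf : lebesgue_measure.-integrable [set: R] (EFin \o (fun x => (x - m) * f x * p x)).
  apply: domi.
    by move=> x; apply: cvgM; [apply: cvgM; [exact: csub|exact: cf]|exact: cp].
  move=> x; apply: le_trans (pq x); rewrite !normrM (ger0_norm (p0 x)).
  rewrite mulrA ler_wpM2r// (le_trans (ler_wpM2l _ (fK x)))//.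
  by have := normr_ge0 (x - m); nra.
have intf' : lebesgue_measure.-integrable [set: R] (EFin \o (fun x => f' x * p x)).
  apply: domi.
    by move=> x; apply: cvgM; [exact: cf'|exact: cp].
  move=> x; apply: le_trans (pq x); rewrite !normrM (ger0_norm (p0 x)).
  rewrite mulrA ler_wpM2r// (le_trans (f'K x))//.
  by have := normr_ge0 (x - m); nra.
have fpC x : `|f x * p x| <= C * q x.
  apply: le_trans (pq x); rewrite !normrM (ger0_norm (p0 x)).
  rewrite mulrA ler_wpM2r// (le_trans (fK x))//.
  by have := normr_ge0 (x - m); nra.
have cvg0 (F : set_system R) : Filter F -> q x @[x --> F] --> 0 ->
    (f \* p) x @[x --> F] --> 0.
  move=> FF q0; apply: norm_cvg0.
  have Cq0 : C * q x @[x --> F] --> 0.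
    by rewrite -[X in _ --> X](mulr0 C); apply: cvgM => //; exact: cvg_cst.
  apply: squeeze_cvgr _ (cvg_cst 0) Cq0.
  by apply: nearW => x; rewrite /= normr_ge0 fpC.
split=> //.
(* This is the derivative of [f * p], since [p' = - (x - m) / s ^+ 2 * p]. *)
pose g x := f' x * p x - s ^- 2 * ((x - m) * f x * p x).
have : \int[lebesgue_measure]_x g x = 0 - 0.
  apply: (@Rintegral_derive_setT _ (f \* p)).
  - move=> x.
    have dfp := is_deriveM (df x) (is_derive_normal_pdf _ m s x s0).
    by apply: (@is_derive_eq _ _ _ _ _ _ _ _ dfp); rewrite /GRing.scale/= /g /p; field.
  - move=> x; apply: cvgB; first by apply: cvgM; [exact: cf'|exact: cp].
    apply: cvgM; first exact: cvg_cst.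
    by apply: cvgM; [apply: cvgM; [exact: csub|exact: cf]|exact: cp].
  - exact: integrableB intf' (integrableZl measurableT (s ^- 2) intf).
  - by apply: cvg0; exact: cvg_normal_fun_pinfty.
  - by apply: cvg0; exact: cvg_normal_fun_ninfty.
rewrite /g RintegralB//; last first.
  exact: (integrableZl measurableT (s ^- 2) intf).
rewrite RintegralZl// subr0 => /eqP; rewrite subr_eq0 => /eqP ->.
by rewrite mulrA divff ?mul1r// expf_neq0.
Qed.

(** * From the normal law to its density *)

Lemma ae_eq_normal_pdf (R : realType) (m s : R) :
  ae_eq (@lebesgue_measure R) [set: R]
    (Radon_Nikodym_SigmaFinite.f (normal_prob m s) (@lebesgue_measure R))
    (fun x => (normal_pdf m s x)%:E).
Proof.
have dom := @normal_prob_dominates R m s.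
apply: integral_ae_eq => //.
- exact: Radon_Nikodym_SigmaFinite.f_integrable.
- by apply/measurable_EFinP; exact: measurable_normal_pdf.
- by move=> A _ mA; rewrite -Radon_Nikodym_SigmaFinite.f_integral.
Qed.

(** Nonnegativity replaces integrability here. Applied to [|f|], this gives the integrability under
    [normal_prob] that the signed formula [Rintegral_normal_prob] requires. *)
Lemma ge0_integral_normal_prob (R : realType) (m s : R) (f : R -> \bar R) :
  measurable_fun [set: R] f -> (forall x, 0 <= f x)%E ->
  (\int[normal_prob m s]_x f x =
   \int[lebesgue_measure]_x (f x * (normal_pdf m s x)%:E))%E.
Proof.
move=> mf f0; have dom := @normal_prob_dominates R m s.
rewrite -(Radon_Nikodym_SigmaFinite.change_of_variables dom)//.
apply: ae_eq_integral => //.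
- apply: emeasurable_funM => //.
  exact: measurable_int (Radon_Nikodym_SigmaFinite.f_integrable dom).
- apply: emeasurable_funM => //; apply/measurable_EFinP.
  exact: measurable_normal_pdf.
- exact/ae_eqe_mul2l/ae_eq_normal_pdf.
Qed.

Lemma integrable_normal_prob (R : realType) (m s : R) (f : R -> R) :
  measurable_fun [set: R] f ->
  lebesgue_measure.-integrable [set: R] (fun x => (f x * normal_pdf m s x)%:E) ->
  (normal_prob m s).-integrable [set: R] (EFin \o f).
Proof.
move=> mf /integrableP[_ intf]; apply/integrableP; split.
  exact/measurable_EFinP.
rewrite ge0_integral_normal_prob//; last first.
  by apply/measurable_EFinP; exact: measurableT_comp.
apply: le_lt_trans intf; rewrite le_eqVlt; apply/orP; left; apply/eqP.
apply: eq_integral => x _ /=.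
by rewrite normrM (ger0_norm (normal_pdf_ge0 _ _ _)).
Qed.

Lemma Rintegral_normal_prob (R : realType) (m s : R) (f : R -> R) :
  measurable_fun [set: R] f ->
  lebesgue_measure.-integrable [set: R] (fun x => (f x * normal_pdf m s x)%:E) ->
  \int[normal_prob m s]_x f x = \int[lebesgue_measure]_x (f x * normal_pdf m s x).
Proof.
move=> mf intf; have dom := @normal_prob_dominates R m s.
congr fine; under [RHS]eq_integral do rewrite EFinM.
rewrite -(Radon_Nikodym_change_of_variables dom)//; last first.
  exact: integrable_normal_prob.
apply: ae_eq_integral => //.
- apply: emeasurable_funM; first exact/measurable_EFinP.
  by apply: (measurable_int (@lebesgue_measure R)); exact: Radon_Nikodym_integrable.
- by apply: (measurable_int (@lebesgue_measure R)); under eq_fun do rewrite -EFinM.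
(* The derivative here is [Radon_Nikodym] rather than [Radon_Nikodym_SigmaFinite.f]; the same
   uniqueness argument identifies it with the density. *)
- apply: ae_eqe_mul2l; apply: integral_ae_eq => //.
  + exact: Radon_Nikodym_integrable.
  + by apply/measurable_EFinP; exact: measurable_normal_pdf.
  + by move=> A _ mA; rewrite -Radon_Nikodym_integral.
Qed.

(** * Stein's identity and moments for normal random variables *)

(** The measure [nu] is left abstract so that the point mass and the nondegenerate normal law are
    treated alike. *)
Lemma integral_law (d d' : measure_display) (T : measurableType d)
    (T' : measurableType d') (R : realType) (P : probability T R)
    (Y : {RV P >-> T'}) (nu : {measure set T' -> \bar R}) (h : T' -> R) :
  (forall A : set T', measurable A -> P (Y @^-1` A) = nu A) ->
  nu.-integrable [set: T'] (EFin \o h) ->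
  P.-integrable [set: T] (EFin \o (h \o Y)) /\
  \int[P]_t h (Y t) = \int[nu]_x h x.
Proof.
move=> lawY /integrableP[/measurable_EFinP mh inth].
have intE (g : T' -> \bar R) :
    (\int[distribution P Y]_x g x = \int[nu]_x g x)%E.
  by apply: eq_measure_integral => A mA _; exact: lawY.
have inthY : P.-integrable [set: T] (EFin \o (h \o Y)).
  apply/integrableP; split.
    by apply/measurable_EFinP; exact: measurableT_comp.
  rewrite -(@ge0_integral_distribution _ _ _ _ _ _ Y
    (fun x => `|(h x)%:E|%E))//; last first.
    by apply: measurableT_comp => //; exact/measurable_EFinP.
  by rewrite intE.
split=> //; congr fine.
rewrite -(@integral_distribution _ _ _ _ _ _ Y (EFin \o h))//.
exact/measurable_EFinP.
Qed.

Lemma normal_law_stein (d : measure_display) (T : measurableType d) (R : realType)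
    (P : probability T R) (Y : {RV P >-> R}) (m s K : R) (f f' : R -> R) :
  (forall A : set R, measurable A -> P (Y @^-1` A) = normal_law m s A) ->
  (forall x, is_derive x (1 : R) f (f' x)) -> continuous f' ->
  (forall x, `|f x| <= K * (1 + `|x - m|)) -> (forall x, `|f' x| <= K) ->
  P.-integrable [set: T] (fun t => ((Y t - m) * f (Y t))%:E) /\
  \int[P]_t ((Y t - m) * f (Y t)) = s ^+ 2 * \int[P]_t f' (Y t).
Proof.
move=> lawY df cf' fK f'K; have cf := is_derive_continuous _ _ _ df.
have mf' : measurable_fun [set: R] f' by exact: continuous_measurable_fun.
pose h x := (x - m) * f x.
have mh : measurable_fun [set: R] h.
  apply: measurable_funM; first exact: measurable_funB.
  exact: continuous_measurable_fun.
(* [normal_prob m s] is a measure on [measurableTypeR R], whose display differs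
   from the one of R although the measurable sets are the same. *)
have mY : measurable_fun setT (Y : T -> measurableTypeR R).
  exact: (measurable_funPT Y).
pose Y' : {RV P >-> measurableTypeR R} :=
  HB.pack (Y : T -> measurableTypeR R) (isMeasurableFun.Build _ _ _ _ _ mY).
(* For the point mass at [m], the left side vanishes because of the factor [x - m] and the right
   side because [s ^+ 2 = 0]. *)
have [s0|s0] := eqVneq s 0.
  have lawm (A : set (measurableTypeR R)) : measurable A ->
      P (Y' @^-1` A) = dirac (m : measurableTypeR R) A.
    by move=> mA; rewrite lawY// /normal_law s0 eqxx.
  have inth : (dirac (m : measurableTypeR R)).-integrable
      [set: measurableTypeR R] (EFin \o h).
    apply/integrableP; split; first exact/measurable_EFinP.
    rewrite integral_dirac//; last by do 2 apply: measurableT_comp => //.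
    by rewrite diracT mul1e ltry.
  have [inthY ->] := integral_law _ _ _ _ _ _ Y' _ h lawm inth.
  split=> //; rewrite s0 expr0n/= mul0r /Rintegral integral_dirac//.
    by rewrite diracT mul1e/= /h subrr mul0r.
  exact/measurable_EFinP.
have [inthp intf'p stein] := normal_pdf_stein _ m s K f f' s0 df cf' fK f'K.
have lawn (A : set (measurableTypeR R)) : measurable A ->
    P (Y' @^-1` A) = normal_prob m s A.
  by move=> mA; rewrite lawY// /normal_law (negbTE s0).
have [inthY ->] := integral_law _ _ _ _ _ _ Y' _ h lawn
  (integrable_normal_prob _ m s h mh inthp).
have [_ ->] := integral_law _ _ _ _ _ _ Y' _ f' lawn
  (integrable_normal_prob _ m s f' mf' intf'p).
by split=> //; rewrite !Rintegral_normal_prob.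
Qed.

(** Stein's identity for the constant [1]. Besides the mean, it supplies the integrable bound used
    to differentiate under the integral in [normal_law_cos]. *)
Lemma normal_law_centered (d : measure_display) (T : measurableType d)
    (R : realType) (P : probability T R) (Y : {RV P >-> R}) (m s : R) :
  (forall A : set R, measurable A -> P (Y @^-1` A) = normal_law m s A) ->
  P.-integrable [set: T] (EFin \o (fun t => Y t - m)) /\
  \int[P]_t (Y t - m) = 0.
Proof.
move=> lawY.
have [int1 E1] : P.-integrable [set: T] (fun t => ((Y t - m) * 1)%:E) /\
    \int[P]_t ((Y t - m) * 1) = s ^+ 2 * \int[P]_t 0.
  apply: (@normal_law_stein _ _ _ _ _ _ _ 1 (cst 1) (cst 0)) => //.
  - by move=> x; exact: cst_continuous.
  - by move=> x; rewrite /= normr1 mul1r lerDl.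
  - by move=> x; rewrite /= normr0.
split; first by apply: eq_integrable int1 => // t _; rewrite mulr1.
rewrite [in RHS]/Rintegral integral0 mulr0 in E1.
by rewrite -[RHS]E1; apply: eq_Rintegral => t _; rewrite mulr1.
Qed.

Lemma integrable_sqr_Lfun2 (d : measure_display) (T : measurableType d)
    (R : realType) (P : {measure set T -> \bar R}) (h : T -> R) :
  measurable_fun [set: T] h ->
  P.-integrable [set: T] (fun t => (h t * h t)%:E) -> h \in Lfun P 2%:E.
Proof.
move=> mh /integrableP[_ inth].
rewrite inE; apply/andP; split; rewrite inE//=.
rewrite /finite_norm unlock; apply: poweR_lty.
apply: le_lt_trans inth; rewrite le_eqVlt; apply/orP; left; apply/eqP.
apply: eq_integral => t _ /=.
by rewrite powR_mulrn// normrM expr2.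
Qed.

(** Stein's identity for [f x = x - m]. It ties the existentially quantified parameters in
    [is_normal] to the prescribed means and covariances. *)
Lemma normal_law_moments (d : measure_display) (T : measurableType d)
    (R : realType) (P : probability T R) (Y : {RV P >-> R}) (m s : R) :
  (forall A : set R, measurable A -> P (Y @^-1` A) = normal_law m s A) ->
  [/\ (Y : T -> R) \in Lfun P 2%:E, 'E_P[Y] = m%:E & 'V_P[Y] = (s ^+ 2)%:E]%E.
Proof.
move=> lawY.
have [_ E1] := normal_law_centered _ _ _ _ _ _ _ lawY.
have [int2 E2] : P.-integrable [set: T] (fun t => ((Y t - m) * (Y t - m))%:E) /\
    \int[P]_t ((Y t - m) * (Y t - m)) = s ^+ 2 * \int[P]_t 1.
  apply: (@normal_law_stein _ _ _ _ _ _ _ 1 (id - cst m) (cst 1)) => //.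
  - by move=> x; apply: is_derive_eq; rewrite subr0.
  - by move=> x; exact: cst_continuous.
  - by move=> x; rewrite /= mul1r lerDr.
  - by move=> x; rewrite /= normr1.
(* Square integrability is known for the centred variable; adding back the constant [m] gives it for
   [Y]. *)
have W2 : ((Y : T -> R) \- cst m) \in Lfun P 2%:E.
  by apply: integrable_sqr_Lfun2 => //; exact: measurable_funB.
have YE : (Y : T -> R) = ((Y : T -> R) \- cst m) \+ cst m.
  by apply/funext => t /=; rewrite subrK.
have Y2 : (Y : T -> R) \in Lfun P 2%:E.
  suff : (Y : T -> R) \- cst m \+ cst m \in Lfun P 2%:E by rewrite -YE.
  have le12 : (1 <= 2%:E :> \bar R)%E by rewrite lee_fin ler1n.
  by apply: (rpredD W2); exact: Lfun_cst.
have W1 := Lfun_subset12 (fin_num_measure P _ measurableT) W2.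
have EY : ('E_P[Y] = m%:E)%E.
  suff : ('E_P[((Y : T -> R) \- cst m \+ cst m)%R] = m%:E)%E by rewrite -YE.
  rewrite expectationD ?Lfun_cst// expectation_cst.
  rewrite (_ : 'E_P[_] = 0)%E ?add0e//.
  rewrite -[LHS]fineK ?expectation_fin_num// unlock; congr EFin.
  exact: E1.
split => //; rewrite /variance unlock EY/= unlock.
move: E2; rewrite (_ : \int[P]_t 1 = 1) ?mulr1 => [<-|]; last first.
  by rewrite /Rintegral integral_cst//= probability_setT mule1.
by rewrite /Rintegral fineK// integrable_fin_num.
Qed.

(** * The expectation of a cosine *)

Lemma bounded_Lfun1 (d : measure_display) (T : measurableType d)
    (R : realType) (P : {finite_measure set T -> \bar R}) (K : R) (h : T -> R) :
  measurable_fun [set: T] h -> (forall t, `|h t| <= K) -> h \in Lfun P 1.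
Proof.
move=> mh hK; apply/Lfun1_integrable/measurable_bounded_integrable => //.
  by rewrite -ge0_fin_numE// fin_num_measure.
by exists K; split=> [|x Kx t _ /=]; rewrite ?num_real// (le_trans (hK t))// ltW.
Qed.

Lemma measurable_cos (R : realType) : measurable_fun [set: R] (@cos R).
Proof. by apply: continuous_measurable_fun; exact: continuous_cos. Qed.

Lemma measurable_sin (R : realType) : measurable_fun [set: R] (@sin R).
Proof. by apply: continuous_measurable_fun; exact: continuous_sin. Qed.

Lemma Lfun1_cos (d : measure_display) (T : measurableType d)
    (R : realType) (P : probability T R) (Y : {RV P >-> R}) (a : R) :
  (fun t => cos (Y t + a)) \in Lfun P 1.
Proof.
apply: (bounded_Lfun1 _ _ _ P 1) => [|t]; last exact: cos_max.
by apply: measurableT_comp; [exact: measurable_cos|exact: measurable_funD].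
Qed.

Lemma normal_law_cos (d : measure_display) (T : measurableType d)
    (R : realType) (P : probability T R) (Y : {RV P >-> R}) (m s a : R) :
  (forall A : set R, measurable A -> P (Y @^-1` A) = normal_law m s A) ->
  \int[P]_t cos (Y t - m + a) = expR (- (s ^+ 2 / 2)) * cos a.
Proof.
move=> lawY.
pose W t := Y t - m.
pose phi u := \int[P]_t cos (u * W t + a).
have intcos u : P.-integrable [set: T] (EFin \o (fun t => cos (u * W t + a))).
  apply/Lfun1_integrable/(bounded_Lfun1 _ _ _ P 1) => [|t]; last exact: cos_max.
  apply: (measurableT_comp (measurable_cos R)).
  apply: measurable_funD => //; apply: measurable_funM => //.
  exact: measurable_funB.
have [intW _] := normal_law_centered _ _ _ _ _ _ _ lawY.
(* Used in the space variable with [c = u], [b = m], and in the frequency [u] with [c = W t],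
   [b = 0]. *)
have darg (c b x : R) : is_derive x (1 : R) (fun y => c * (y - b) + a) c.
  have := @is_derive_eq _ _ _ (c *: (id - cst b) + cst a) x 1 c _ _.
  apply; rewrite /GRing.scale/=; ring.
have dphi u : is_derive u (1 : R) phi (- (s ^+ 2 * u) * phi u).
  have [intsin Esin] : P.-integrable [set: T] (fun t => (W t * sin (u * W t + a))%:E) /\
      \int[P]_t (W t * sin (u * W t + a)) =
      s ^+ 2 * \int[P]_t (u * cos (u * W t + a)).
    (* The constant has to bound both the sine, by [1], and its derivative, by [|u|]. *)
    apply: (@normal_law_stein _ _ _ _ _ _ _ (1 + `|u|)
      (fun y => sin (u * (y - m) + a)) (fun y => u * cos (u * (y - m) + a))) => //.
    - move=> x; rewrite mulrC.
      exact: is_derive1_comp (is_derive_sin _) (darg u m x).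
    - move=> x; apply: cvgM; first exact: cvg_cst.
      apply: (is_derive_continuous _ _ _ (fun y =>
        is_derive1_comp (is_derive_cos _) (darg u m y))).
    - move=> x; rewrite (le_trans (sin_max _))//.
      by have := normr_ge0 u; have := normr_ge0 (x - m); nra.
    - move=> x; rewrite normrM; have := cos_max (u * (x - m) + a).
      by have := normr_ge0 u; nra.
  have dcos v t : is_derive v (1 : R) (fun w => cos (w * W t + a))
      (- (W t * sin (v * W t + a))).
    have := is_derive1_comp (is_derive_cos _) (darg (W t) 0 v).
    rewrite /comp; under eq_fun do rewrite subr0 mulrC.
    by rewrite subr0 mulNr mulrC (mulrC v).
  (* Differentiation under the integral needs only a neighbourhood of [u]; the bound [|W t|] is
     uniform in the frequency. *)
  have Iu : `]u - 1, u + 1[%classic u.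
    by rewrite /= in_itv/= ltrBlDr ltrDl ltr01.
  have d1E v t : partial1of2 (fun w t => cos (w * W t + a)) v t =
      - (W t * sin (v * W t + a)).
    by rewrite partial1of2E; apply: derive_val.
  have dom v t : `]u - 1, u + 1[%classic v -> [set: T] t ->
      `|partial1of2 (fun w t => cos (w * W t + a)) v t| <= `|W t|.
    by move=> _ _; rewrite d1E normrN normrM ler_piMr// sin_max.
  have intaW : P.-integrable [set: T] (EFin \o (fun t => `|W t|)).
    exact: integrable_norm.
  have dcos' v t : `]u - 1, u + 1[%classic v -> [set: T] t ->
      derivable (fun w : R => cos (w * W t + a)) v 1.
    by move=> _ _; case: (dcos v t).
  apply: DeriveDef.
    exact: (derivable_under_integral measurableT Iu (fun v _ => intcos v) dcos'
      (fun t => normr_ge0 (W t)) intaW dom).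
  rewrite -derive1E (differentiation_under_integral measurableT Iu
    (fun v _ => intcos v) dcos' (fun t => normr_ge0 (W t)) intaW dom).
  under eq_Rintegral do rewrite d1E -mulN1r.
  by rewrite RintegralZl// Esin RintegralZl//; rewrite /phi; ring.
(* The integrating factor of [phi' = - s ^+ 2 * u * phi] makes [psi] constant; comparing its values
   at [1] and [0] gives the formula. *)
pose psi u := expR (s ^+ 2 / 2 * u ^+ 2) * phi u.
have dpsi u : is_derive u (1 : R) psi 0.
  have dq : is_derive u (1 : R) (fun v => s ^+ 2 / 2 * v ^+ 2) (s ^+ 2 * u).
    have := @is_derive_eq _ _ _ ((s ^+ 2 / 2) *: (id : R -> R) ^+ 2 : R -> R)
      u 1 (s ^+ 2 * u) _ _.
    by apply; rewrite /GRing.scale/=; field.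
  have de := is_derive1_comp (is_derive_expR _) dq.
  apply: (is_derive_eq (is_deriveM de (dphi u))).
  by rewrite /GRing.scale/=; ring.
have := is_derive_0_is_cst 1 0 dpsi.
rewrite /psi expr1n mulr1 expr0n/= mulr0 expR0 mul1r => E.
rewrite expRN; apply: (canRL (mulKf _)); first by rewrite gt_eqF ?expR_gt0.
move: E; rewrite /phi.
under eq_Rintegral do rewrite mul1r.
move=> ->.
under eq_Rintegral do rewrite mul0r add0r.
by rewrite /Rintegral integral_cst//= probability_setT mule1.
Qed.

(** * Application to jointly normal variables *)

Lemma is_normal_Lfun2 (d : measure_display) (T : measurableType d)
    (R : realType) (P : probability T R) (Y : {RV P >-> R}) :
  is_normal P Y -> (Y : T -> R) \in Lfun P 2%:E.
Proof.
by move=> [m [s [_ lawY]]]; have [] := normal_law_moments _ _ _ _ _ _ _ lawY.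
Qed.

(** The phase [a] lets one formula yield cosines, with [a = 0], and sines, with [a = - (pi / 2)]. *)
Lemma expectation_cos_normal (d : measure_display) (T : measurableType d)
    (R : realType) (P : probability T R) (Y : {RV P >-> R}) (m v a : R) :
  is_normal P Y -> ('E_P[Y] = m%:E)%E -> ('V_P[Y] = v%:E)%E ->
  ('E_P[fun t => cos (Y t + a)] = (expR (- (v / 2)) * cos (m + a))%:E)%E.
Proof.
move=> [m' [s [_ lawY]]].
have [_ -> ->] := normal_law_moments _ _ _ _ _ _ _ lawY => -[<-] [<-].
rewrite -(normal_law_cos _ _ _ _ _ _ _ _ lawY) /Rintegral.
under [in RHS]eq_integral do rewrite addrA subrK.
rewrite expectation.unlock fineK//; apply: integrable_fin_num => //.
exact: ((Lfun1_integrable P _).1 (Lfun1_cos _ _ _ P Y a)).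
Qed.

Theorem lemmaG2 (R : realType) (mu1 mu2 nu11 nu22 nu12 : R)
    (hnu : psd (sym_mx2 nu11 nu22 nu12))
    (d : measure_display) (T : measurableType d) (P : probability T R)
    (X1 X2 : {RV P >-> R})
    (hX : jointly_normal_with X1 X2 mu1 mu2 nu11 nu22 nu12) :
  let nus := - ((nu11 + nu22) / 2) in
  covariance P (sin \o X1) (sin \o X2) =
    (2^-1 * (expR (nus + nu12) - expR nus) * cos (mu1 - mu2)
     - 2^-1 * (expR (nus - nu12) - expR nus) * cos (mu1 + mu2))%:E.
Proof.
case: hX => hN [E1 E2] [V1 V2 C12] nus.
have N1 : is_normal P X1.
  have := hN 1 0; congr is_normal.
  by apply/funext => t; rewrite mul1r mul0r addr0.
have N2 : is_normal P X2.
  have := hN 0 1; congr is_normal.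
  by apply/funext => t; rewrite mul1r mul0r add0r.
(* Difference and sum are formed in the ring of measurable functions, so that they are again random
   variables. *)
pose XB : {RV P >-> R} := (X1 : {mfun T >-> R}) - (X2 : {mfun T >-> R}).
pose XD : {RV P >-> R} := (X1 : {mfun T >-> R}) + (X2 : {mfun T >-> R}).
have NB : is_normal P XB.
  by have := hN 1 (-1); congr is_normal; apply/funext => t; rewrite mul1r mulN1r.
have ND : is_normal P XD.
  by have := hN 1 1; congr is_normal; apply/funext => t; rewrite !mul1r.
have L1 := is_normal_Lfun2 _ _ _ _ _ N1.
have L2 := is_normal_Lfun2 _ _ _ _ _ N2.
have Pfin := fin_num_measure P _ measurableT.
have I1 := Lfun_subset12 Pfin L1.
have I2 := Lfun_subset12 Pfin L2.
have EB : ('E_P[XB] = (mu1 - mu2)%:E)%E by rewrite [LHS]expectationB// E1 E2.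
have ED : ('E_P[XD] = (mu1 + mu2)%:E)%E by rewrite [LHS]expectationD// E1 E2.
have VB : ('V_P[XB] = (nu11 + nu22 - 2 * nu12)%:E)%E.
  by rewrite [LHS]varianceB// /variance V1 V2 C12.
have VD : ('V_P[XD] = (nu11 + nu22 + 2 * nu12)%:E)%E.
  by rewrite [LHS]varianceD// /variance V1 V2 C12.
have cosB_ := expectation_cos_normal _ _ _ _ _ _ _ 0 NB EB VB.
have cosD_ := expectation_cos_normal _ _ _ _ _ _ _ 0 ND ED VD.
have sin1 := expectation_cos_normal _ _ _ _ _ _ _ (- (pi / 2)) N1 E1 V1.
have sin2 := expectation_cos_normal _ _ _ _ _ _ _ (- (pi / 2)) N2 E2 V2.
have sinE (X : {RV P >-> R}) : sin \o X = fun t => cos (X t + - (pi / 2)).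
  by apply/funext => t; rewrite cosBpihalf.
have msin (X : {RV P >-> R}) : measurable_fun [set: T] (sin \o X).
  by apply: measurableT_comp => //; exact: measurable_sin.
have Lsin (X : {RV P >-> R}) : sin \o X \in Lfun P 1.
  by apply: (bounded_Lfun1 _ _ _ P 1) => // t; exact: sin_max.
rewrite covarianceE//; last first.
  apply: (bounded_Lfun1 _ _ _ P 1) => [|t]; first exact: measurable_funM.
  by rewrite normrM mulr_ile1 ?sin_max.
have -> : (sin \o X1) * (sin \o X2) =
    2^-1 \o* ((fun t => cos (XB t + 0)) \- (fun t => cos (XD t + 0))).
  apply/funext => t; rewrite /= !addr0 cosB cosD.
  have -> : ((sin \o X1) * (sin \o X2)) t = sin (X1 t) * sin (X2 t) by [].
  by field.
rewrite expectationZl; last by rewrite rpredB ?Lfun1_cos.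
rewrite expectationB ?Lfun1_cos// cosB_ cosD_ !sinE sin1 sin2 !cosBpihalf !addr0.
rewrite -EFinB; congr EFin.
have -> : nus + nu12 = - ((nu11 + nu22 - 2 * nu12) / 2) by rewrite /nus; field.
have -> : nus - nu12 = - ((nu11 + nu22 + 2 * nu12) / 2) by rewrite /nus; field.
(* This is the factor in the product of the two sine expectations; expanding the cosines turns
   [sin mu1 * sin mu2] into the [expR nus] terms of the claim. *)
have -> : expR nus = expR (- (nu11 / 2)) * expR (- (nu22 / 2)).
  by rewrite -expRD /nus; congr expR; field.
by rewrite cosB cosD; field.
Qed.
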